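(* The number $g_n$ of non-isomorphic simple graphs on $n$ vertices satisfies $$g_n=\frac1{n!}\sum_{\sigma\in S_n}\sum_{j=0}^{\lfloor m/2\rfloor}(m-2j+1)\,\chi^{(m-j,j)}(\varphi(\sigma)),$$ where $m=\binom n2$, $\chi^{(m-j,j)}$ is the character of the Specht module $S^{(m-j,j)}$ (over $\mathbb C$) of the symmetric group $S_m$, and $\varphi(\sigma)\in S_m$ is the permutation of edges of $K_n$ induced by the permutation $\sigma$ of vertices.
   Context: The set $[m]=\{1,\dots,m\}$ is identified with the set of $2$-element subsets of $\{1,\dots,n\}$ (edges of the complete graph $K_n$) via the lexicographic order, and $\varphi:S_n\to S_m$ is the homomorphism given by $\varphi(\sigma):\{i,j\}\mapsto\{\sigma(i),\sigma(j)\}$. *)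

(* Defs.v *)
From HB Require Import structures.
From mathcomp Require Import all_boot all_order all_fingroup all_algebra.
From mathcomp Require Import mxrepresentation.
Set Implicit Arguments.
Unset Strict Implicit.
Unset Printing Implicit Defensive.

Import GRing.Theory.
Local Open Scope nat_scope.

(* A simple graph on the vertex set ['I_n] is represented by its set of edges. *)
Definition sgraph (n : nat) :=
  {E : {set {set 'I_n}} | [forall e in E, #|e| == 2]}.

Definition adj n (G : sgraph n) : rel 'I_n :=
  fun x y => [set x; y] \in val G.

Definition sgraph_iso n : rel (sgraph n) :=
  fun G H => [exists s : 'S_n, forall x, forall y, adj G x y == adj H (s x) (s y)].

Lemma sgraph_isoP n (G H : sgraph n) :
  reflect (exists s : 'S_n, forall x y, adj G x y = adj H (s x) (s y))
          (sgraph_iso G H).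
Proof.
apply: (iffP existsP) => -[s Hs]; exists s.
  by move=> x y; apply/eqP; move: Hs => /forallP/(_ x)/forallP/(_ y).
by apply/forallP => x; apply/forallP => y; rewrite Hs.
Qed.

Lemma sgraph_iso_equiv n :
  {in [set: sgraph n] & &, equivalence_rel (@sgraph_iso n)}.
Proof.
have symm G H : @sgraph_iso n G H -> sgraph_iso H G.
  by move=> /sgraph_isoP[s Hs]; apply/sgraph_isoP; exists s^-1%g => x y;
     rewrite Hs !permKV.
have trns G H K : @sgraph_iso n G H -> sgraph_iso H K -> sgraph_iso G K.
  move=> /sgraph_isoP[s Hs] /sgraph_isoP[t Ht].
  by apply/sgraph_isoP; exists (s * t)%g => x y; rewrite !permM -Ht Hs.
move=> G H K _ _ _; split.
  by apply/sgraph_isoP; exists 1%g => x y; rewrite !perm1.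
by move=> GH; apply/idP/idP; apply: trns; [apply: symm|].
Qed.

Definition num_graphs (n : nat) : nat :=
  #|equivalence_partition (@sgraph_iso n) [set: sgraph n]|.

(* The list [{0,1}; {0,2}; ...; {0,n-1}; {1,2}; ...] in lexicographic order;
   its [k]-th item is the 2-subset identified with [k : 'I_('C(n, 2))]. *)
Definition edge_seq (n : nat) : seq {set 'I_n} :=
  [seq [set i; j] | i : 'I_n <- enum 'I_n,
                  j : 'I_n <- [seq k : 'I_n <- enum 'I_n | i < k]].

Lemma mem_edge_seq n (e : {set 'I_n}) : (e \in edge_seq n) = (#|e| == 2).
Proof.
apply/allpairsPdep/cards2P => [[i [j [_]]]|[i [j [ne_ij ->]]]].
  rewrite mem_filter => /andP[lt_ij _] ->; exists i, j; split=> //.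
  by rewrite -val_eqE neq_ltn lt_ij.
move: ne_ij; rewrite -val_eqE neq_ltn /= => /orP[lt_ij|lt_ji].
  by exists i, j; split; rewrite ?mem_enum // mem_filter lt_ij mem_enum.
exists j, i; split; rewrite ?mem_enum // 1?setUC //.
by rewrite mem_filter lt_ji mem_enum.
Qed.

Lemma edge_seq_uniq n : uniq (edge_seq n).
Proof.
apply: allpairs_uniq_dep; [exact: enum_uniq| |].
  by move=> i _; apply: filter_uniq; exact: enum_uniq.
move=> _ _ /allpairsPdep[i [j [_ + ->]]] /allpairsPdep[k [l [_ + ->]]] /=.
rewrite !mem_filter => /andP[lt_ij _] /andP[lt_kl _] eq_e.
have: i \in [set k; l] by rewrite -eq_e set21.
have: j \in [set k; l] by rewrite -eq_e set22.
rewrite !inE => /orP[]/eqP jE /orP[]/eqP iE; subst=> //.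
- by rewrite ltnn in lt_ij.
- by have := ltn_trans lt_ij lt_kl; rewrite ltnn.
- by rewrite ltnn in lt_ij.
Qed.

Lemma size_edge_seq n : size (edge_seq n) = 'C(n, 2).
Proof.
rewrite -(card_uniqP (edge_seq_uniq n)) -[n in RHS]card_ord -cardsT -cards_draws.
by apply: eq_card => e; rewrite mem_edge_seq !inE subsetT.
Qed.

Definition edge n (k : 'I_('C(n, 2))) : {set 'I_n} := nth set0 (edge_seq n) k.

Lemma card_edge n (k : 'I_('C(n, 2))) : #|edge k| = 2.
Proof.
by apply/eqP; rewrite -mem_edge_seq mem_nth // size_edge_seq.
Qed.

Lemma edge_inj n : injective (@edge n).
Proof.
move=> k l /eqP; rewrite nth_uniq ?size_edge_seq ?edge_seq_uniq //.
by move/eqP/val_inj.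
Qed.

Lemma edge_fun_subproof n (s : 'S_n) (k : 'I_('C(n, 2))) :
  index (s @: edge k) (edge_seq n) < 'C(n, 2).
Proof.
rewrite -size_edge_seq index_mem mem_edge_seq.
by rewrite card_imset ?card_edge //; apply: perm_inj.
Qed.

Definition edge_fun n (s : 'S_n) (k : 'I_('C(n, 2))) : 'I_('C(n, 2)) :=
  Ordinal (edge_fun_subproof s k).

Lemma edge_funE n (s : 'S_n) k : edge (edge_fun s k) = s @: edge k.
Proof.
rewrite /edge nth_index // mem_edge_seq.
by rewrite card_imset ?card_edge //; apply: perm_inj.
Qed.

Lemma edge_fun_inj n (s : 'S_n) : injective (edge_fun s).
Proof.
move=> k l /(congr1 (@edge n)); rewrite !edge_funE.
by move/(imset_inj (@perm_inj _ s))/edge_inj.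
Qed.

Definition edge_perm n (s : 'S_n) : 'S_('C(n, 2)) := perm (@edge_fun_inj n s).

Lemma edge_permE n (s : 'S_n) k : edge (edge_perm s k) = s @: edge k.
Proof. by rewrite permE edge_funE. Qed.

Lemma edge_permM n :
  {in [set: 'S_n] &, {morph @edge_perm n : s t / (s * t)%g}}.
Proof.
move=> s t _ _; apply/permP => k; apply: edge_inj.
rewrite permM !edge_permE -imset_comp.
by apply: eq_imset => x; rewrite /= permM.
Qed.

Canonical edge_perm_morphism n := Morphism (@edge_permM n).

(* A partition [la] of [m] is a weakly decreasing sequence of naturals with sum
   [m]; trailing zeros are harmless, they only create empty rows. *)
Section Specht.

Variables (m : nat) (la : seq nat).

(* A box is a pair (row, column). *)
Local Notation box := ('I_(size la) * 'I_(sumn la))%type.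

Definition young_diagram : {set box} := [set b : box | b.2 < nth 0 la b.1].

(* A tableau is a bijection between the boxes and the entries ['I_m]; it is
   represented by the inverse bijection, which gives the box of each entry. *)
Definition tableau :=
  {t : {ffun 'I_m -> box} | injectiveb t && ([set t k | k : 'I_m] == young_diagram)}.

(* A tabloid (a tableau up to permutations within the rows) is represented by
   the function that gives the row of each entry. *)
Definition tabloid :=
  {f : {ffun 'I_m -> 'I_(size la)} |
    [forall r, #|[set k | f k == r]| == nth 0 la r]}.

Lemma card_row (r : 'I_(size la)) :
  #|[set b in young_diagram | b.1 == r]| = nth 0 la r.
Proof.
have le_r : nth 0 la r <= sumn la.
  by rewrite sumnE (big_nth 0) big_mkord (bigD1 r) //= leq_addr.
rewrite -[RHS]card_ord -(card_imset _ (f := fun c => (r, widen_ord le_r c))).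
  apply: eq_card => -[r' c]; rewrite !inE /=.
  apply/andP/imsetP => [[lt_c /eqP eq_r]|[c' _ [-> ->]]] /=; last by rewrite ltn_ord.
  subst r'; exists (Ordinal lt_c) => //; congr pair; exact: val_inj.
by move=> c d [] /val_inj.
Qed.

Lemma tabloid_of_subproof (t : tableau) :
  [forall r, #|[set k | [ffun k => (val t k).1] k == r]| == nth 0 la r].
Proof.
case: t => t /= /andP[/injectiveP t_inj /eqP t_im].
apply/forallP => r; rewrite -card_row -(card_imset _ t_inj).
apply/eqP/eq_card => b; rewrite inE -t_im; apply/imsetP/andP.
  by case=> k; rewrite inE ffunE => rk ->; split=> //; apply: imset_f.
by case=> /imsetP[k _ ->] rk; exists k => //; rewrite inE ffunE.
Qed.

Definition tabloid_of (t : tableau) : tabloid :=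
  Sub [ffun k => (val t k).1] (tabloid_of_subproof t).

(* [S_m] acts on tableaux and tabloids by replacing each entry [k] by [s k]. *)
Lemma tableau_act_subproof (t : tableau) (s : 'S_m) :
  let t' := [ffun k => val t (s^-1%g k)] in
  injectiveb t' && ([set t' k | k : 'I_m] == young_diagram).
Proof.
case: t => t /= /andP[/injectiveP t_inj /eqP t_im].
apply/andP; split.
  by apply/injectiveP => k l; rewrite !ffunE => /t_inj/perm_inj.
apply/eqP; rewrite -t_im; apply/setP => b.
apply/imsetP/imsetP => -[k _ ->].
  by exists (s^-1%g k) => //; rewrite ffunE.
by exists (s k) => //; rewrite ffunE permK.
Qed.

Definition tableau_act (t : tableau) (s : 'S_m) : tableau :=
  Sub [ffun k => val t (s^-1%g k)] (tableau_act_subproof t s).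

Lemma tabloid_act_subproof (f : tabloid) (s : 'S_m) :
  [forall r, #|[set k | [ffun k => val f (s^-1%g k)] k == r]| == nth 0 la r].
Proof.
apply/forallP => r; move/forallP: (valP f) => /(_ r) /eqP <-.
rewrite -(card_imset _ (@perm_inj _ s^-1%g)).
apply/eqP/eq_card => k; rewrite inE; apply/imsetP/idP.
  by case=> l; rewrite inE ffunE => fl ->.
by move=> fk; exists (s k); rewrite ?inE ?ffunE permK.
Qed.

Definition tabloid_act (f : tabloid) (s : 'S_m) : tabloid :=
  Sub [ffun k => val f (s^-1%g k)] (tabloid_act_subproof f s).

Lemma tabloid_act1 (f : tabloid) : tabloid_act f 1%g = f.
Proof. by apply/val_inj/ffunP => k; rewrite ffunE invg1 perm1. Qed.

Lemma tabloid_actM (f : tabloid) (s t : 'S_m) :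
  tabloid_act f (s * t)%g = tabloid_act (tabloid_act f s) t.
Proof. by apply/val_inj/ffunP => k; rewrite !ffunE invMg permM. Qed.

Lemma tabloid_of_act (t : tableau) (s : 'S_m) :
  tabloid_of (tableau_act t s) = tabloid_act (tabloid_of t) s.
Proof. by apply/val_inj/ffunP => k; rewrite !ffunE. Qed.

Definition col_stab (t : tableau) : {set 'S_m} :=
  [set s : 'S_m | [forall k, (val t (s k)).2 == (val t k).2]].

Lemma col_stab_act (t : tableau) (s x : 'S_m) :
  ((x ^ s)%g \in col_stab (tableau_act t s)) = (x \in col_stab t).
Proof.
rewrite !inE; apply/forallP/forallP => H k.
  by have := H (s k); rewrite /= !ffunE conjgE !permM !permK.
have := H (s^-1%g k); rewrite /= !ffunE conjgE !permM.
by rewrite permK.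
Qed.

Variable F : fieldType.

Local Open Scope ring_scope.

(* The permutation module on tabloids: the row vectors indexed by tabloids, on
   which [S_m] acts on the right. *)
Definition tabloid_vec (f : tabloid) : 'rV[F]_#|{: tabloid}| :=
  delta_mx 0 (enum_rank f).

Definition tabloid_mx (s : 'S_m) : 'M[F]_#|{: tabloid}| :=
  \matrix_i tabloid_vec (tabloid_act (enum_val i) s).

Lemma tabloid_vec_act (f : tabloid) (s : 'S_m) :
  tabloid_vec f *m tabloid_mx s = tabloid_vec (tabloid_act f s).
Proof. by rewrite -rowE rowK enum_rankK. Qed.

Lemma tabloid_mx_repr : mx_repr [set: 'S_m] tabloid_mx.
Proof.
split=> [|s t _ _].
  by apply/row_matrixP => i; rewrite rowK row1 tabloid_act1 /tabloid_vec enum_valK.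
apply/row_matrixP => i; rewrite row_mul !rowK.
by rewrite tabloid_vec_act tabloid_actM.
Qed.

Canonical tabloid_repr := MxRepresentation tabloid_mx_repr.

Definition polytabloid (t : tableau) : 'rV[F]_#|{: tabloid}| :=
  \sum_(x in col_stab t) (-1) ^+ x *: tabloid_vec (tabloid_act (tabloid_of t) x).

Lemma polytabloid_act (t : tableau) (s : 'S_m) :
  polytabloid t *m tabloid_mx s = polytabloid (tableau_act t s).
Proof.
rewrite mulmx_suml [RHS](reindex_inj (conjg_inj s)) /=.
apply: eq_big => [x|x _]; first by rewrite col_stab_act.
rewrite -scalemxAl tabloid_vec_act odd_permJ; congr (_ *: tabloid_vec _).
by rewrite tabloid_of_act -!tabloid_actM conjgC.
Qed.

Definition specht : 'M[F]_#|{: tabloid}| :=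
  (\sum_(t : tableau) <<polytabloid t>>)%MS.

Lemma specht_module : mxmodule tabloid_repr specht.
Proof.
apply/mxmoduleP => s _; rewrite sumsmxMr.
apply/sumsmx_subP => t _.
rewrite (eqmxMr _ (genmxE _)) polytabloid_act.
by apply: (sumsmx_sup (tableau_act t s)) => //; rewrite genmxE.
Qed.

Definition specht_repr := submod_repr specht_module.

Definition specht_char (s : 'S_m) : F := \tr (specht_repr s).

End Specht.

Arguments specht_char {m} la F s.

(* Main.v *)
Require Import Defs.
From mathcomp Require Import all_boot all_order all_fingroup all_algebra.
From mathcomp Require Import mxrepresentation.
From mathcomp Require Import reals complex zify.
Set Implicit Arguments.
Unset Strict Implicit.
Unset Printing Implicit Defensive.

Import GRing.Theory Num.Theory.
Local Open Scope ring_scope.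

(** Identify a simple graph with its set of edges, a subset of the [m] edges of
    the complete graph.  Isomorphism classes are then the orbits of ['S_n] on
    the subsets of ['I_m], so by the Cauchy-Frobenius formula
    ([sum_fixed_sets]) the number of graphs is the average over [s] of the
    number of subsets fixed by [edge_perm s].  It remains to express the number
    of subsets of ['I_m] fixed by a permutation [s] through the characters of
    the two-row Specht modules ([card_fixed_sets]).

    A tabloid of shape [(m - k, k)] is a [k]-subset of ['I_m] (its second row),
    so the permutation module [M_k] on these tabloids has the number of fixed
    [k]-subsets as its character.  Young's rule for two rows says that, for
    [2 k <= m], this character is the sum of the Specht characters of
    [(m - j, j)] for [j <= k] ([young_rule]).  As complementation exchanges the
    fixed [k]-subsets and the fixed [(m - k)]-subsets, summing over all [k]
    counts the Specht character of index [j] once for each [k] such that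
    [j <= k <= m - j], that is, [m - 2 j + 1] times.

    Young's rule follows from an equivariant exact sequence
    [0 -> S_(k+1) -> M_(k+1) -> M_k -> 0], whose second map [D] sends a subset to
    the sum of the subsets obtained by removing one element, and whose first term
    is the Specht module.  Three facts give it, for [2 (k + 1) <= m]:
    - [D] kills the polytabloids, because these change sign under the exchange of
      the two entries of a column ([polytabloid_down]);
    - [D] is surjective ([down_mx_full]);
    - the Specht module and the image of the transpose of [D] together span
      [M_(k+1)] ([specht_add_up]), so that the dimension of the Specht module is
      at least the dimension of the kernel of [D].

    For the last two facts, write a subset as the product of its elements.  A
    polytabloid is a product of [k] differences [x - y], and it can be compared
    with a subset through the products of fewer differences and some of the
    elements ([diff_vec]).  Both [D] and its transpose have a simple expression
    on these products, because they do not see the factors [x - y], and trading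
    one element [z] for a difference [z - w] gives the required spanning
    statements by induction on the number of remaining elements
    ([diff_vec_sub_down], [diff_vec_sub_up]).  This involves dividing by
    positive integers only. *)

Definition fixed_sets m (s : 'S_m) : {set {set 'I_m}} :=
  [set X : {set 'I_m} | s @: X == X].

(** If [D] intertwines [rG x] and [B] and is surjective with kernel [U], then [B] is
    the action of [x] on the quotient by [U], and traces add up.  The proof
    splits the trace along the projections [E] onto [U] and [D *m P], where [P]
    is a linear section of [D]. *)
Lemma mxtrace_sub_ker (F : fieldType) (gT : finGroupType) (G : {group gT}) n p
    (rG : mx_representation F G n) (U : 'M_n) (modU : mxmodule rG U)
    (D : 'M_(n, p)) (B : 'M_p) (x : gT) :
    x \in G -> (U :=: kermx D)%MS -> row_full D -> rG x *m D = D *m B ->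
  \tr (submod_repr modU x) + \tr B = \tr (rG x).
Proof.
move=> Gx defU /row_fullP[P PD] xD.
pose K := in_submod U 1%:M; pose V := val_submod (1%:M : 'M_(\rank U)).
pose E := 1%:M - D *m P.
have sEU : (E <= U)%MS.
  rewrite defU; apply/sub_kermxP.
  by rewrite mulmxBl mul1mx -mulmxA PD mulmx1 subrr.
have defE : E = E *m K *m V.
  by rewrite -[LHS](in_submodK sEU) in_submodE val_submodE.
have VxD : V *m rG x *m D = 0.
  apply/sub_kermxP; rewrite -defU (submx_trans _ (mxmoduleP modU x Gx)) //.
  by rewrite submxMr // val_submod1.
have -> : \tr (rG x) = \tr (rG x *m E) + \tr (rG x *m D *m P).
  by rewrite -mxtraceD -mulmxA -mulmxDr subrK mulmx1.
rewrite xD -mulmxA [\tr (D *m _)]mxtrace_mulC -mulmxA PD mulmx1; congr (_ + _).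
rewrite defE mulmxA [RHS]mxtrace_mulC (mulmxA (rG x)) !(mulmxA V).
have -> : V *m rG x *m E = V *m rG x.
  by rewrite mulmxBr mulmx1 mulmxA VxD mul0mx subr0.
by rewrite -in_submodE.
Qed.

(** * Tabloids of two-row shape as subsets *)

Section TwoRow.

Variables (F : numFieldType) (m : nat).

Local Notation shape k := [:: (m - k)%N; k].
Local Notation tab k := (tabloid m (shape k)).

Definition lower_row k (f : tab k) : {set 'I_m} := [set i | (val f i : nat) == 1%N].

Lemma card_lower_row k (f : tab k) : #|lower_row f| = k.
Proof.
have /forallP/(_ (Ordinal (isT : 1 < 2)%N))/eqP card_f := valP f.
by apply: etrans card_f; apply: eq_card => i; rewrite !inE.
Qed.

Lemma lower_row_inj k : injective (@lower_row k).
Proof.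
move=> f g /setP eq_fg; apply/val_inj/ffunP => i; apply/val_inj.
have := eq_fg i; rewrite !inE.
by case: (val f i) => [[|[|[]]] // ?]; case: (val g i) => [[|[|[]]] // ?].
Qed.

Lemma lower_row_onto k (X : {set 'I_m}) : #|X| = k -> exists f : tab k, lower_row f = X.
Proof.
move=> cardX.
pose g := [ffun i => if i \in X then Ordinal (isT : 1 < 2)%N
                                 else Ordinal (isT : 0 < 2)%N].
have gP : [forall r : 'I_(size (shape k)),
             #|[set i | g i == r]| == nth 0%N (shape k) r].
  apply/forallP => -[[|[|[]]] // lt_r] /=; apply/eqP.
    have -> : (m - k = #|~: X|)%N by rewrite [RHS]cardsCs setCK cardX card_ord.
    apply: eq_card => i.
    by rewrite !inE ffunE -val_eqE; case: ifP.
  apply: etrans cardX; apply: eq_card => i.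
  by rewrite !inE ffunE -val_eqE; case: ifP.
exists (Sub g gP); apply/setP => i; rewrite !inE ffunE.
by case: ifP.
Qed.

Lemma lower_row_act k (f : tab k) (s : 'S_m) : lower_row (tabloid_act f s) = s @: lower_row f.
Proof.
apply/setP => i; rewrite inE ffunE -[i in RHS](permKV s).
by rewrite (mem_imset _ _ perm_inj) inE.
Qed.

Definition set_vec k (X : {set 'I_m}) : 'rV[F]_#|{: tab k}| :=
  \row_i (lower_row (enum_val i) == X)%:R.

Lemma tabloid_vec_lower_row k (f : tab k) : tabloid_vec F f = set_vec k (lower_row f).
Proof.
apply/rowP => i; rewrite !mxE eqxx (inj_eq (@lower_row_inj k)) /=.
by rewrite -{1}(enum_valK i) (inj_eq enum_rank_inj).
Qed.

Lemma set_vec_act k (X : {set 'I_m}) (s : 'S_m) : #|X| = k ->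
  set_vec k X *m tabloid_mx (shape k) F s = set_vec k (s @: X).
Proof.
by move=> /lower_row_onto[f <-]; rewrite -tabloid_vec_lower_row tabloid_vec_act
  tabloid_vec_lower_row lower_row_act.
Qed.

(** The vectors being rows that are multiplied on the right, this matrix is the map
    [M_(k+1) -> M_k] that removes one element in all possible ways, and its
    transpose adds one element in all possible ways. *)
Definition down_mx k : 'M[F]_(#|{: tab k.+1}|, #|{: tab k}|) :=
  \matrix_(i, j) (lower_row (enum_val j) \subset lower_row (enum_val i))%:R.

Lemma set_vec_down k (X : {set 'I_m}) : #|X| = k.+1 ->
  set_vec k.+1 X *m down_mx k = \sum_(x in X) set_vec k (X :\ x).
Proof.
move=> cardX; have [f defX] := lower_row_onto cardX.
rewrite -defX -tabloid_vec_lower_row -rowE defX; apply/rowP => j.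
rewrite !mxE summxE enum_rankK defX.
under eq_bigr do rewrite mxE.
have cardY := card_lower_row (enum_val j); set Y := lower_row _ in cardY *.
have [sYX | nsYX] := boolP (Y \subset X); last first.
  rewrite big1 // => x _; case: eqP => // defY.
  by rewrite defY subsetDl in nsYX.
have /cards1P[x0 Dx0] : #|X :\: Y| == 1%N.
  by rewrite cardsD (setIidPr sYX) cardX cardY subSnn.
have := set11 x0; rewrite -Dx0 inE => /andP[x0Y x0X].
have defY : Y = X :\ x0 by rewrite -Dx0 setDDr setDv set0U (setIidPr sYX).
rewrite (bigD1 x0) //= -defY eqxx big1 ?addr0 // => x /andP[xX ne_x].
by case: eqP => // /setP/(_ x); rewrite defY !inE eqxx ne_x xX.
Qed.

Lemma set_vec_up k (Y : {set 'I_m}) : #|Y| = k ->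
  set_vec k Y *m (down_mx k)^T = \sum_(w | w \notin Y) set_vec k.+1 (w |: Y).
Proof.
move=> cardY; have [f defY] := lower_row_onto cardY.
rewrite -defY -tabloid_vec_lower_row -rowE defY; apply/rowP => j.
rewrite !mxE summxE enum_rankK defY.
under eq_bigr do rewrite mxE.
have cardX := card_lower_row (enum_val j); set X := lower_row _ in cardX *.
have [sYX | nsYX] := boolP (Y \subset X); last first.
  rewrite big1 // => x _; case: eqP => // defX.
  by rewrite defX subsetUr in nsYX.
have /cards1P[x0 Dx0] : #|X :\: Y| == 1%N.
  by rewrite cardsD (setIidPr sYX) cardX cardY subSnn.
have := set11 x0; rewrite -Dx0 inE => /andP[x0Y x0X].
have defX : X = x0 |: Y by rewrite -Dx0 setUC -{1}(setID X Y) (setIidPr sYX).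
rewrite (bigD1 x0) //= -defX eqxx big1 ?addr0 // => x /andP[xY ne_x].
by case: eqP => // /setP/(_ x); rewrite defX !inE eqxx (negPf ne_x) (negPf xY).
Qed.

Lemma down_mx_act k (s : 'S_m) :
  tabloid_mx (shape k.+1) F s *m down_mx k = down_mx k *m tabloid_mx (shape k) F s.
Proof.
apply/row_matrixP => i; rewrite !row_mul rowK tabloid_vec_lower_row lower_row_act.
rewrite set_vec_down ?card_imset ?card_lower_row //; last exact: perm_inj.
have -> : row i (down_mx k) = set_vec k.+1 (lower_row (enum_val i)) *m down_mx k.
  by rewrite -tabloid_vec_lower_row -rowE enum_valK.
rewrite set_vec_down ?card_lower_row // mulmx_suml big_imset /=; last first.
  by move=> x y _ _ /perm_inj.
apply: eq_bigr => x xX; rewrite set_vec_act; last first.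
  by apply: eq_add_S; rewrite -[RHS](card_lower_row (enum_val i)) [in RHS](cardsD1 x) xX.
congr (set_vec k _); apply/setP => y.
rewrite -(permKV s y) in_setD1 !(mem_imset _ _ perm_inj) in_setD1.
by rewrite (inj_eq perm_inj).
Qed.

(** * Products of differences *)

Fixpoint ends (l : seq ('I_m * 'I_m)) : seq 'I_m :=
  if l is p :: l' then [:: p.1, p.2 & ends l'] else [::].

(** All the entries of the pairs in [l] are distinct, and none is in [Z]. *)
Definition independent l (Z : {set 'I_m}) :=
  uniq (ends l) && all (fun x => x \notin Z) (ends l).

(** If a subset is seen as the square-free monomial in its elements, this is the
    product of the differences [p.1 - p.2] for [p] in [l] and of the elements of
    [Z], expanded in the basis of the [k]-subsets. *)
Fixpoint diff_vec k (l : seq ('I_m * 'I_m)) (Z : {set 'I_m}) : 'rV[F]_#|{: tab k}| :=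
  if l is p :: l' then diff_vec k l' (p.1 |: Z) - diff_vec k l' (p.2 |: Z)
  else set_vec k Z.

Lemma independent_cons x y l (Z : {set 'I_m}) : independent ((x, y) :: l) Z ->
  [/\ x \notin Z, y \notin Z, x != y,
      independent l (x |: Z) & independent l (y |: Z)].
Proof.
rewrite /independent /= !inE negb_or.
move=> /and3P[/and3P[/andP[ne_xy xl] yl ul] xZ /andP[yZ /allP lZ]].
split=> //; rewrite ul /=; apply/allP => z zl; rewrite !inE negb_or lZ // andbT.
  by apply: contraNneq xl => <-.
by apply: contraNneq yl => <-.
Qed.

Lemma independentS l (Y Z : {set 'I_m}) :
  Y \subset Z -> independent l Z -> independent l Y.
Proof.
move=> /subsetP sYZ /andP[ul /allP lZ]; rewrite /independent ul /=.
by apply/allP => z /lZ; apply/contra/sYZ.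
Qed.

(** Removing an element acts as a derivation, which kills the factors [x - y]. *)
Lemma diff_vec_down k l (Z : {set 'I_m}) : independent l Z -> (size l + #|Z| = k.+1)%N ->
  diff_vec k.+1 l Z *m down_mx k = \sum_(z in Z) diff_vec k l (Z :\ z).
Proof.
elim: l Z => [|[x y] l IHl] Z; first by move=> _; apply: set_vec_down.
move=> /independent_cons[xZ yZ _ indx indy] /= sizek.
rewrite mulmxBl !IHl // ?cardsU1 ?xZ ?yZ -?sizek ?addnS //.
rewrite !big_setU1 //= !setU1K // opprD addrACA subrr add0r sumrB.
congr (_ - _); apply: eq_bigr => z zZ; congr (diff_vec k l _).
  rewrite setDUl; congr (_ :|: _); apply/setP => t; rewrite !inE andbC.
  by case: eqP => //= ->; apply: contraNneq xZ => ->.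
rewrite setDUl; congr (_ :|: _); apply/setP => t; rewrite !inE andbC.
by case: eqP => //= ->; apply: contraNneq yZ => ->.
Qed.

(** Adding [y] to the term with [x] and adding [x] to the term with [y] give the
    same monomial with opposite signs, so only the elements outside the pairs
    contribute. *)
Lemma diff_vec_up k l (Z : {set 'I_m}) : independent l Z -> (size l + #|Z| = k)%N ->
  diff_vec k l Z *m (down_mx k)^T =
    \sum_(w | (w \notin Z) && (w \notin ends l)) diff_vec k.+1 l (w |: Z).
Proof.
elim: l Z => [|[x y] l IHl] Z.
  move=> _ cardZ; rewrite set_vec_up //; apply: eq_bigl => w /=.
  by rewrite andbT.
move=> ind /=; have [xZ yZ ne_xy indx indy] := independent_cons ind.
move=> sizek.
have [xl yl] : x \notin ends l /\ y \notin ends l.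
  by case/andP: ind => /=; rewrite inE negb_or => /and3P[/andP[]].
rewrite mulmxBl !IHl // ?cardsU1 ?xZ ?yZ -?sizek ?addnS //.
rewrite (bigD1 y) /=; last by rewrite !inE negb_or eq_sym ne_xy yZ.
rewrite [X in _ - X](bigD1 x) /=; last by rewrite !inE negb_or ne_xy xZ.
rewrite setUCA opprD addrACA subrr add0r sumrB.
congr (_ - _).
  apply: eq_big => [w|w _]; last by rewrite setUCA.
  by rewrite !inE !negb_or; do !case: (_ \notin _); rewrite //= ?andbT ?andbF.
apply: eq_big => [w|w _]; last by rewrite setUCA.
by rewrite !inE !negb_or; do !case: (_ \notin _); rewrite //= ?andbT ?andbF // andbC.
Qed.

(** The product of [l], of [z - w] and of the rest of [Z] is the difference of two
    products with the differences of [l] only; this is how the number of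
    differences grows in the next inductions. *)
Lemma independent_swap l (Z : {set 'I_m}) z w :
    independent l Z -> z \in Z -> w \notin Z -> w \notin ends l ->
  independent ((z, w) :: l) (Z :\ z).
Proof.
move=> indZ zZ wZ wl; have [/= ul /allP lZ] := andP indZ.
have zl : z \notin ends l by apply/negP => /lZ; rewrite zZ.
have ne_zw : z != w by apply: contraNneq wZ => <-.
rewrite /independent /= inE negb_or ne_zw zl wl ul !inE eqxx (negPf wZ) andbF /=.
by apply/allP => i /lZ; rewrite inE => /negPf->; rewrite andbF.
Qed.

Lemma submx_natr_scale p n (V : 'M[F]_(p, n)) (v : 'rV_n) d :
  (0 < d)%N -> (v *+ d <= V)%MS -> (v <= V)%MS.
Proof.
move=> d_gt0; rewrite -scaler_nat.
by rewrite eqmx_scale // pnatr_eq0 -lt0n.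
Qed.

(** Modulo the image of the map that adds an element, the sum of [diff_vec l (w Z')]
    over all possible [w] vanishes, where [Z'] is [Z] without [z].  Up to products
    with one more difference [z - w], all these terms are equal to
    [diff_vec l Z], hence a positive multiple of it is a combination of products
    with more differences. *)
Lemma diff_vec_sub_up k p (V : 'M[F]_(p, _)) :
    (forall l, independent l set0 -> size l = k.+1 ->
       (diff_vec k.+1 l set0 <= V)%MS) ->
    ((down_mx k)^T <= V)%MS ->
  forall l Z, independent l Z -> (size l + #|Z| = k.+1)%N ->
    (diff_vec k.+1 l Z <= V)%MS.
Proof.
move=> baseV upV l Z; move: {2}#|Z| (erefl #|Z|) => n.
elim: n l Z => [|n IHn] l Z cardZ indZ sizek.
  move: cardZ indZ sizek => /eqP; rewrite cards_eq0 => /eqP ->.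
  by rewrite cards0 addn0; apply: baseV.
have [z zZ] : exists z, z \in Z by apply/set0Pn; rewrite -card_gt0 cardZ.
have cardZ' : #|Z :\ z| = n by apply: eq_add_S; rewrite -cardZ (cardsD1 z Z) zZ.
have zl : z \notin ends l.
  by apply/negP => /(allP (proj2 (andP indZ))); rewrite zZ.
pose P w := (w \notin Z :\ z) && (w \notin ends l).
have Pz : P z by rewrite /P zl !inE eqxx.
apply: (@submx_natr_scale _ _ _ _ #|P|); first by apply/card_gt0P; exists z.
rewrite -sumr_const.
have := @diff_vec_up k l (Z :\ z).
rewrite cardZ' (independentS (subsetDl _ _) indZ); move=> /(_ isT).
have sizek' : (size l + n = k)%N by lia.
move=> /(_ sizek') up_eq.
(* The term w = z is the vector itself, so that the sum has at least one term. *)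
rewrite -[X in (X <= _)%MS](subrK (\sum_(w in P) diff_vec k.+1 l (w |: (Z :\ z)))).
rewrite -sumrB addmx_sub //; last by rewrite -up_eq mulmx_sub.
apply: summx_sub => w /andP[wZ wl].
rewrite -{1}(setD1K zZ).
have [-> | ne_wz] := eqVneq w z; first by rewrite subrr sub0mx.
apply: (IHn ((z, w) :: l)) => //=; last by rewrite cardZ' addSn sizek'.
apply: independent_swap => //.
by move: wZ; rewrite !inE ne_wz.
Qed.

Lemma size_ends (l : seq ('I_m * 'I_m)) : size (ends l) = (2 * size l)%N.
Proof. by elim: l => //= p l ->; lia. Qed.

(** This is where the bound [2 k <= m] enters the surjectivity of [down_mx]. *)
Lemma exists_fresh (l : seq ('I_m * 'I_m)) (Z : {set 'I_m}) :
  (2 * size l + #|Z| < m)%N -> exists2 w, w \notin Z & w \notin ends l.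
Proof.
move=> lt_m; have : (#|[predU Z & ends l]| < m)%N.
  apply: leq_ltn_trans lt_m; rewrite addnC -size_ends.
  apply: leq_trans (leq_add (leqnn _) (card_size (ends l))).
  by rewrite -cardUI leq_addr.
rewrite -[X in (_ < X)%N -> _]card_ord -[X in (_ < X)%N -> _](cardC [predU Z & ends l]).
rewrite -[X in (X < _)%N -> _]addn0 ltn_add2l => /card_gt0P[w].
by rewrite !inE negb_or => /andP[]; exists w.
Qed.

(** For an unused [w], removing an element from the product of [l], [w] and [Z]
    gives [diff_vec l Z] plus, for each [z] in [Z], the product where [w] replaces
    [z].  Up to a product with the additional difference [z - w], each of the
    latter is again [diff_vec l Z], which thus occurs [#|Z| + 1] times. *)
Lemma diff_vec_sub_down k l (Z : {set 'I_m}) : (2 * k.+1 <= m)%N ->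
    independent l Z -> (size l + #|Z| = k)%N ->
  (diff_vec k l Z <= down_mx k)%MS.
Proof.
move=> le_km; move: {2}#|Z| (erefl #|Z|) => n.
elim: n l Z => [|n IHn] l Z cardZ indZ sizek.
all: have [|w wZ wl] := @exists_fresh l Z; first by lia.
all: have indw : independent l (w |: Z)
  by move: indZ => /andP[ul /allP lZ]; rewrite /independent ul;
     apply/allP => i il; rewrite !inE negb_or lZ // andbT;
     apply: contraNneq wl => <-.
all: have := @diff_vec_down k l (w |: Z) indw.
all: rewrite cardsU1 wZ addnCA sizek => /(_ erefl).
all: rewrite big_setU1 //= setU1K // => down_eq.
  move: down_eq; rewrite [\sum_(i in Z) _]big1 ?addr0 => [<-|i iZ].
    by rewrite submxMl.
  by move: cardZ iZ => /eqP; rewrite cards_eq0 => /eqP ->; rewrite inE.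
apply: (@submx_natr_scale _ _ _ _ n.+2) => //.
rewrite mulrS -cardZ -sumr_const.
have -> : diff_vec k l Z + \sum_(z in Z) diff_vec k l Z =
  diff_vec k.+1 l (w |: Z) *m down_mx k +
    \sum_(z in Z) diff_vec k ((z, w) :: l) (Z :\ z).
  rewrite down_eq -addrA -big_split; congr (_ + _).
  apply: eq_bigr => z zZ /=; rewrite (setD1K zZ) setDUl.
  rewrite [[set w] :\ z](_ : _ = [set w]); first by rewrite addrC subrK.
  by apply/setP => i; rewrite !inE andbC; case: eqP => //= ->;
     apply: contraNneq wZ => ->.
rewrite addmx_sub ?submxMl // summx_sub // => z zZ.
apply: IHn; first by apply: eq_add_S; rewrite -cardZ (cardsD1 z Z) zZ.
  exact: independent_swap.
by move: sizek; rewrite (cardsD1 z Z) zZ /=; lia.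
Qed.

Lemma tabloid_row_full k p (V : 'M[F]_(p, #|{: tab k}|)) :
  (forall Z : {set 'I_m}, #|Z| = k -> (set_vec k Z <= V)%MS) -> row_full V.
Proof.
move=> subV; rewrite -sub1mx; apply/row_subP => i.
rewrite rowE mulmx1 -(enum_valK i).
rewrite -[delta_mx _ _]/(tabloid_vec F (enum_val i)) tabloid_vec_lower_row.
by apply: subV; apply: card_lower_row.
Qed.

Lemma down_mx_full k : (2 * k.+1 <= m)%N -> row_full (down_mx k).
Proof.
move=> le_km; apply: tabloid_row_full => Z cardZ.
exact: (@diff_vec_sub_down _ [::]).
Qed.

(** * Polytabloids *)

(** For disjoint pairs, the group generated by the transpositions of these pairs;
    it is the column stabiliser of a tableau whose columns of height two are the
    pairs of [l]. *)
Definition swap_group (l : seq ('I_m * 'I_m)) : {set 'S_m} :=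
  [set s : 'S_m | [forall i, [|| s i == i, (i, s i) \in l | (s i, i) \in l]]].

Lemma mem_ends (l : seq ('I_m * 'I_m)) p :
  p \in l -> p.1 \in ends l /\ p.2 \in ends l.
Proof.
elim: l => //= q l IHl; rewrite !inE => /predU1P[-> | /IHl[-> ->]].
  by rewrite !eqxx orbT.
by rewrite !orbT.
Qed.

Lemma swap_group_nil : swap_group [::] = [set 1%g].
Proof.
apply/setP => s; rewrite !inE; apply/forallP/eqP => [s1 | -> i].
  by apply/permP => i; have:= s1 i; rewrite perm1 ?orbF => /eqP.
by rewrite perm1 eqxx.
Qed.

(** The subgroup for [l] has index two, and the two cosets are distinguished by
    whether [x] is fixed. *)
Lemma swap_group_cons x y l (V : zmodType) (G : 'S_m -> V) :
    uniq (ends ((x, y) :: l)) ->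
  \sum_(s in swap_group ((x, y) :: l)) G s =
    \sum_(s in swap_group l) (G s + G (tperm x y * s)%g).
Proof.
rewrite /= inE negb_or => /and3P[/andP[ne_xy xl] yl ul].
have fix_out s i : s \in swap_group l -> i \notin ends l -> s i = i.
  rewrite inE => /forallP/(_ i)/or3P[/eqP// | /mem_ends[/= il _] | /mem_ends[/= _ il]];
  by rewrite il.
have part_cons s i : s \in swap_group ((x, y) :: l) ->
    i \notin ends l -> [\/ s i = i, i = x /\ s i = y | i = y /\ s i = x].
  rewrite inE => /forallP/(_ i); rewrite !inE => /or3P[/eqP | | ].
  - by constructor 1.
  - case/predU1P => [[-> ->] | /mem_ends[/= il _]]; [by constructor 2 | by rewrite il].
  case/predU1P => [[-> ->] | /mem_ends[/= _ il]]; [by constructor 3 | by rewrite il].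
rewrite big_split /= (bigID (fun s : 'S_m => s x == x)) /=; congr (_ + _).
  apply: eq_bigl => s; apply/andP/idP => [[sG /eqP sx] | sG].
    rewrite inE; apply/forallP => i.
    have sy : s y = y.
      case: (part_cons s y sG yl) => [//|[eq_yx]|[_ sy]].
        by rewrite eq_yx eqxx in ne_xy.
      by move: ne_xy; rewrite -(inj_eq (@perm_inj _ s)) sx sy eqxx.
    have [-> | ne_ix] := eqVneq i x; first by rewrite sx eqxx.
    have [-> | ne_iy] := eqVneq i y; first by rewrite sy eqxx.
    move: sG; rewrite inE => /forallP/(_ i).
    by rewrite !inE !xpair_eqE (negPf ne_ix) (negPf ne_iy) /= andbF.
  split; last by rewrite (fix_out s).
  rewrite inE; apply/forallP => i; move: sG; rewrite inE => /forallP/(_ i).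
  by rewrite !inE => /or3P[] ->; rewrite ?orbT.
rewrite [RHS](reindex_inj (mulgI (tperm x y))) /=.
rewrite (eq_bigr (fun s => G (tperm x y * (tperm x y * s))%g)); last first.
  by move=> s _; rewrite mulgA tperm2 mul1g.
apply: eq_bigl => s; apply/andP/idP => [[sG sx] | tsG].
  have sxE : s x = y.
    case: (part_cons s x sG xl) => [eq_sx | [_ ->] // | [eq_xy]].
      by rewrite eq_sx eqxx in sx.
    by rewrite eq_xy eqxx in ne_xy.
  have syE : s y = x.
    case: (part_cons s y sG yl) => [eq_sy | [eq_yx] | [_ ->] //].
      by move: ne_xy; rewrite -(inj_eq (@perm_inj _ s)) sxE eq_sy eqxx.
    by rewrite eq_yx eqxx in ne_xy.
  rewrite inE; apply/forallP => i; rewrite permM.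
  case: tpermP => [-> | -> | /eqP ne_ix /eqP ne_iy]; rewrite ?syE ?sxE ?eqxx //.
  move: sG; rewrite inE => /forallP/(_ i).
  by rewrite !inE !xpair_eqE (negPf ne_ix) (negPf ne_iy) /= andbF.
have syE : s y = x by rewrite -(fix_out _ x tsG xl) permM tpermL.
have sxE : s x = y by rewrite -(fix_out _ y tsG yl) permM tpermR.
rewrite sxE eq_sym ne_xy; split=> //; rewrite inE; apply/forallP => i.
have [-> | ne_ix] := eqVneq i x; first by rewrite sxE !inE eqxx /= orbT.
have [-> | ne_iy] := eqVneq i y; first by rewrite syE !inE eqxx /= !orbT.
move: tsG; rewrite inE => /forallP/(_ i); rewrite permM tpermD 1?eq_sym //.
by rewrite !inE => /or3P[] ->; rewrite ?orbT.
Qed.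

(** Expanding the product of differences amounts to antisymmetrising one of its
    monomials under the exchanges of the pairs. *)
Lemma diff_vec_swap_group k l (Z : {set 'I_m}) : independent l Z ->
  diff_vec k l Z =
    \sum_(s in swap_group l)
      (-1) ^+ s *: set_vec k (s @: (Z :|: [set x in unzip1 l])).
Proof.
elim: l Z => [|[x y] l IHl] Z ind.
  rewrite swap_group_nil big_set1 odd_perm1 expr0 scale1r /=; congr (set_vec k _).
  rewrite set_nil setU0; apply/esym/setP => i.
  by rewrite -{1}(perm1 i) (mem_imset _ _ perm_inj).
have [xZ yZ ne_xy indx indy] := independent_cons ind.
have ul := proj1 (andP ind).
rewrite swap_group_cons //= !IHl // -sumrB; apply: eq_bigr => s _.
rewrite odd_permM odd_tperm ne_xy signr_addb expr1 mulN1r scaleNr.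
have xZl : x |: Z :|: [set z in unzip1 l] = Z :|: [set z in x :: unzip1 l].
  by rewrite set_cons setUA (setUC [set x]).
rewrite xZl; congr (_ - _ *: set_vec k _).
rewrite [RHS](eq_imset (g := s \o tperm x y)); last by move=> i; rewrite permM.
rewrite imset_comp; congr (s @: (_ : {set _})); apply/setP => i.
move: ul => /= ; rewrite inE negb_or => /and3P[/andP[_ xl] yl _].
have sub1 j : j \in unzip1 l -> j \in ends l.
  by case/mapP => p /mem_ends[pl _] ->.
rewrite -[i in RHS](tpermK x y) (mem_imset _ _ perm_inj) !inE.
case: tpermP => [-> | -> | /eqP ne_ix /eqP ne_iy].
- rewrite (negPf ne_xy) (negPf xZ) (negPf yZ) (eq_sym y) (negPf ne_xy) /=.
  by apply/idP/idP => [/sub1|/sub1]; rewrite ?(negPf xl) ?(negPf yl).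
- by rewrite !eqxx /= orbT.
by rewrite (negPf ne_ix) (negPf ne_iy).
Qed.

Lemma polytabloid_sub la (t : tableau m la) :
  (polytabloid F t <= specht m la F)%MS.
Proof. by apply: (sumsmx_sup t) => //; rewrite genmxE. Qed.

Section BoxOf.

Variables (k : nat) (le_km : (2 * k <= m)%N).

Lemma box_of_row_subproof (j : 'I_m) :
  ((m - k <= j)%N < size (shape k))%N.
Proof. by case: (m - k <= j)%N. Qed.

Lemma box_of_col_subproof (j : 'I_m) :
  (j - (m - k <= j) * (m - k) < sumn (shape k))%N.
Proof. by have := ltn_ord j; rewrite /=; case: leqP; lia. Qed.

(** The entries are put in the boxes along the first row, then along the second
    one. *)
Definition box_of (j : 'I_m) : 'I_(size (shape k)) * 'I_(sumn (shape k)) :=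
  (Ordinal (box_of_row_subproof j), Ordinal (box_of_col_subproof j)).

Lemma tableau_of_subproof (p : 'S_m) :
  let t := [ffun i => box_of (p i)] in
  injectiveb t && ([set t i | i : 'I_m] == young_diagram (shape k)).
Proof.
apply/andP; split.
  apply/injectiveP => i j; rewrite !ffunE => -[].
  move=> eq_row eq_col; apply: (@perm_inj _ p); apply: val_inj => /=.
  move: eq_row eq_col.
  by case: (leqP (m - k) (p i)); case: (leqP (m - k) (p j)) => //= + + _; lia.
apply/eqP/setP => -[[r lt_r] [c lt_c]]; rewrite !inE /=.
apply/imsetP/idP => [[i _] | lt_cr].
  rewrite ffunE => -[-> ->]; have := ltn_ord (p i).
  by case: (leqP (m - k) (p i)) => /=; rewrite ?mul1n ?mul0n; move: (nat_of_ord (p i)) => q; lia.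
have lt_j : (c + r * (m - k) < m)%N.
  by move: lt_r lt_cr; case: r => [|[]] //= _; lia.
exists (p^-1%g (Ordinal lt_j)) => //; rewrite ffunE permKV.
move: lt_r lt_cr; case: r lt_j => [|[]] //= lt_j lt_r lt_cr.
all: by congr pair; apply: val_inj => /=; case: (leqP (m - k)) => /=; lia.
Qed.

Definition tableau_of (p : 'S_m) : tableau m (shape k) :=
  Sub [ffun i => box_of (p i)] (tableau_of_subproof p).

End BoxOf.

(** A product of [k] differences is the polytabloid of a tableau that has the pairs
    as its columns of height two: the elements [p.1] form the second row, and the
    elements [p.2], followed by those that are in no pair, form the first row. *)
Lemma diff_vec_sub_specht k l : (2 * k <= m)%N -> independent l set0 ->
  size l = k -> (diff_vec k l set0 <= specht m (shape k) F)%MS.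
Proof.
move=> le_km indl size_l.
have [ul _] := andP indl.
have perm_ends : perm_eq (ends l) (unzip2 l ++ unzip1 l).
  elim: (l) => //= -[x y] l' /seq.permP IHl; apply/seq.permP => a /=.
  by rewrite count_cat /= IHl count_cat addnCA; congr addn; rewrite addnCA.
(* The reading word of the tableau: the first row, then the second row. *)
pose rest := [seq i <- enum 'I_m | i \notin ends l].
pose e := unzip2 l ++ rest ++ unzip1 l.
have perm_e : perm_eq e (ends l ++ rest).
  by apply/seq.permP => a; rewrite !count_cat (seq.permP perm_ends) count_cat; lia.
have ue : uniq e.
  rewrite (perm_uniq perm_e) cat_uniq ul filter_uniq ?enum_uniq // andbT /=.
  by apply/hasPn => i; rewrite mem_filter => /andP[].
have mem_e i : i \in e.
  by rewrite (perm_mem perm_e) mem_cat mem_filter mem_enum andbT orbN.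
have size_e : size e = m.
  rewrite -(card_uniqP ue) -[RHS]card_ord; apply: eq_card => i.
  by rewrite mem_e.
have lt_index i : (index i e < m)%N.
  by have := mem_e i; rewrite -index_mem size_e.
have index_e_inj : injective (fun i => Ordinal (lt_index i)).
  by move=> i j [] /(congr1 (nth i e)); rewrite !nth_index.
pose p := perm index_e_inj; pose t := tableau_of le_km p.
have pE i : p i = index i e :> nat by rewrite permE.
have size_r : size rest = (m - 2 * k)%N.
  by move: size_e; rewrite !size_cat !size_map size_l; move: (size rest); clear; lia.
have p_snd c d : (c < k)%N -> p (nth d l c).2 = c :> nat.
  move=> lt_c; rewrite pE -(nth_map _ d.2) ?size_l //.
  have <- : nth d.2 e c = nth d.2 (unzip2 l) c.
    by rewrite nth_cat size_map size_l lt_c.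
  by rewrite index_uniq // size_e; lia.
have p_fst c d : (c < k)%N -> p (nth d l c).1 = (m - k + c)%N :> nat.
  move=> lt_c; rewrite pE -(nth_map _ d.1) ?size_l //.
  have <- : nth d.1 e (m - k + c) = nth d.1 (unzip1 l) c.
    rewrite !nth_cat size_map size_l size_r !ifF; try lia.
    by congr nth; lia.
  by rewrite index_uniq // size_e; lia.
have snd_p d j : (p j < k)%N -> j = (nth d l (p j)).2.
  by move=> lt_j; apply/(@perm_inj _ p)/val_inj; rewrite /= p_snd.
have fst_p d i : (m - k <= p i)%N -> i = (nth d l (p i - (m - k))).1.
  move=> le_i; have := ltn_ord (p i) => lt_i.
  by apply/(@perm_inj _ p)/val_inj; rewrite /= p_fst; lia.
have p_mem i j : (i, j) \in l -> (p j < k)%N /\ (p i = m - k + p j :> nat)%N.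
  move=> ij_l; have lt_k : (index (i, j) l < k)%N by rewrite -size_l index_mem.
  have := p_fst _ (i, j) lt_k; have := p_snd _ (i, j) lt_k.
  by rewrite nth_index //= => -> ->.
have lower_row_t : lower_row (tabloid_of t) = [set x in unzip1 l].
  apply/setP => i; rewrite !inE !ffunE /= eqb1.
  apply/idP/mapP => [le_i | [[i' j] ij_l ->]].
    exists (nth (i, i) l (p i - (m - k))); last exact: fst_p.
    rewrite mem_nth // size_l; have := ltn_ord (p i).
    by move: le_i (le_km); move: (nat_of_ord (p i)) => q; clear; lia.
  by have [_ ->] := p_mem _ _ ij_l; rewrite leq_addr.
have notlow c : (c < k)%N -> (m - k <= c)%N = false.
  by move: (le_km); clear; lia.
have stab_t : col_stab t = swap_group l.
  apply/setP => s; rewrite !inE; apply: eq_forallb => i.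
  move: (s i) => j; rewrite !ffunE -val_eqE /=.
  apply/eqP/or3P => [|[/eqP-> // | ij_l | ji_l]]; last 2 first.
  - by have [lt_j ->] := p_mem _ _ ij_l; rewrite leq_addr notlow // mul1n addKn subn0.
  - by have [lt_i ->] := p_mem _ _ ji_l; rewrite leq_addr notlow // mul1n addKn subn0.
  have := ltn_ord (p i); have := ltn_ord (p j).
  case: (leqP (m - k) (p j)); case: (leqP (m - k) (p i)) => /=;
    rewrite ?mul1n ?mul0n ?subn0 => le_i le_j lt_j lt_i eq_c.
  - constructor 1; apply/eqP/(@perm_inj _ p)/val_inj => /=.
    by move: eq_c le_i le_j; move: (nat_of_ord (p i)) (nat_of_ord (p j)); clear; lia.
  - constructor 3.
    have lt_k : (p i < k)%N.
      by move: eq_c lt_j le_j (le_km); move: (nat_of_ord (p i)) (nat_of_ord (p j)); clear; lia.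
    suff -> : (j, i) = nth (i, i) l (p i) by rewrite mem_nth ?size_l.
    by rewrite [RHS]surjective_pairing -snd_p // -eq_c -fst_p.
  - constructor 2.
    have lt_k : (p j < k)%N.
      by move: eq_c lt_i le_i (le_km); move: (nat_of_ord (p i)) (nat_of_ord (p j)); clear; lia.
    suff -> : (i, j) = nth (i, i) l (p j) by rewrite mem_nth ?size_l.
    by rewrite [RHS]surjective_pairing -snd_p // eq_c -fst_p.
  - constructor 1; apply/eqP/(@perm_inj _ p)/val_inj => /=.
    by move: eq_c le_i le_j; move: (nat_of_ord (p i)) (nat_of_ord (p j)); clear; lia.
suff -> : diff_vec k l set0 = polytabloid F t by apply: polytabloid_sub.
rewrite diff_vec_swap_group // /polytabloid stab_t; apply: eq_bigr => s _.
by rewrite tabloid_vec_lower_row lower_row_act lower_row_t set0U.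
Qed.

Lemma tabloid_mx_fix k (v : 'rV[F]_#|{: tab k}|) (s : 'S_m) i :
  s @: lower_row (enum_val i) = lower_row (enum_val i) ->
  (v *m tabloid_mx (shape k) F s) 0 i = v 0 i.
Proof.
rewrite -lower_row_act => /lower_row_inj fix_i; rewrite mxE (bigD1 i) //= big1 ?addr0.
  by rewrite !mxE fix_i enum_valK !eqxx mulr1.
move=> j ne_ji; rewrite !mxE eqxx /= -(inj_eq enum_val_inj) enum_rankK.
case: eqP => [eq_i | _]; last by rewrite mulr0.
case/eqP: ne_ji; apply/enum_val_inj/lower_row_inj/(imset_inj (@perm_inj _ s)).
by rewrite -!lower_row_act -eq_i fix_i.
Qed.

Lemma polytabloid_tperm la (t : tableau m la) x y :
    x != y -> tperm x y \in col_stab t ->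
  polytabloid F t *m tabloid_mx la F (tperm x y) = - polytabloid F t.
Proof.
move=> ne_xy xy_stab.
rewrite mulmx_suml -sumrN [LHS](reindex_inj (mulIg (tperm x y))) /=.
apply: eq_big => [z | z _].
  rewrite !inE; apply: eq_forallb => j; rewrite permM.
  by move: xy_stab; rewrite inE => /forallP/(_ (z j))/eqP ->.
rewrite -scalemxAl tabloid_vec_act -tabloid_actM -mulgA tperm2 mulg1.
by rewrite odd_permM odd_tperm ne_xy addbT signrN scaleNr.
Qed.

(** A [k]-subset [Y] misses one of the first [k + 1] columns.  The exchange of the
    two entries of this column fixes [Y] and changes the sign of the
    polytabloid, so the coefficient of the image at [Y] is its own opposite. *)
Lemma polytabloid_down k (t : tableau m (shape k.+1)) :
  (2 * k.+1 <= m)%N -> polytabloid F t *m down_mx k = 0.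
Proof.
move=> le_km; apply/rowP => i; rewrite [RHS]mxE.
set Y := lower_row (enum_val i).
have cardY : #|Y| = k := card_lower_row _.
case/andP: (valP t) => _ /eqP t_im.
have lt_box (r : 'I_2) c : (c < k.+1)%N ->
  exists x, (val t x).1 = r :> nat /\ (val t x).2 = c :> nat.
  move=> lt_c.
  have lt_c' : (c < sumn (shape k.+1))%N by rewrite /=; lia.
  have : (r, Ordinal lt_c') \in young_diagram (shape k.+1).
    by rewrite inE /=; case: r => -[|[]] //= _; lia.
  by move/setP: t_im => /(_ (r, Ordinal lt_c')) <- /imsetP[x _ eq_x];
     exists x; rewrite -eq_x.
have [c lt_c Yc] : exists2 c, (c < k.+1)%N &
    forall x, x \in Y -> (val t x).2 != c :> nat.
  have /subsetPn[c _ Yc] : ~~ ([set: 'I_k.+1] \subset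
        [set inord (val t x).2 | x in Y]).
    apply/negP => /subset_leq_card; rewrite cardsT card_ord leqNgt ltnS.
    by rewrite (leq_trans (leq_imset_card _ _)) // cardY.
  exists c => // x xY; apply: contra Yc => /eqP eq_c.
  by apply/imsetP; exists x => //; rewrite eq_c inord_val.
have [x [x1 x2]] := lt_box (Ordinal (isT : 1 < 2)%N) c lt_c.
have [y [y1 y2]] := lt_box (Ordinal (isT : 0 < 2)%N) c lt_c.
have ne_xy : x != y by apply/eqP => eq_xy; rewrite eq_xy y1 in x1.
pose s := tperm x y.
have sY : s @: Y = Y.
  apply/setP => z; rewrite -{1}(permKV s z) (mem_imset _ _ perm_inj) tpermV.
  by case: tpermP => // ->; apply/idP/idP => /Yc; rewrite ?x2 ?y2 eqxx.
have s_stab : s \in col_stab t.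
  rewrite inE; apply/forallP => z; apply/eqP/val_inj.
  by rewrite /s; case: tpermP => [->|->|] //=; rewrite x2 y2.
have eq_pt : polytabloid F t *m tabloid_mx (shape k.+1) F s = - polytabloid F t.
  exact: polytabloid_tperm.
have : polytabloid F t *m down_mx k = - (polytabloid F t *m down_mx k) *m tabloid_mx (shape k) F s.
  by rewrite mulNmx -mulmxA -down_mx_act mulmxA eq_pt mulNmx opprK.
move/rowP/(_ i); rewrite tabloid_mx_fix // [in RHS]mxE => eq_opp.
by apply/eqP; rewrite -[_ == 0](mulrn_eq0 _ 2) mulr2n {2}eq_opp subrr.
Qed.

(** * Specht modules and fixed subsets *)

Lemma specht_add_up k : (2 * k.+1 <= m)%N ->
  row_full (specht m (shape k.+1) F + (down_mx k)^T)%MS.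
Proof.
move=> le_km; apply: tabloid_row_full => Z cardZ.
apply: (@diff_vec_sub_up k _ _ _ _ [::] Z) => //; last exact: addsmxSr.
move=> l indl size_l; apply: submx_trans (addsmxSl _ _).
exact: diff_vec_sub_specht.
Qed.

(** One inclusion is that polytabloids are killed; the other one is a comparison of
    ranks, as the Specht module together with a space of dimension
    [\rank (down_mx k)] spans everything. *)
Lemma specht_eq_ker k : (2 * k.+1 <= m)%N ->
  (specht m (shape k.+1) F :=: kermx (down_mx k))%MS.
Proof.
move=> le_km; apply/eqmxP.
have sub : (specht m (shape k.+1) F <= kermx (down_mx k))%MS.
  apply/sumsmx_subP => t _; rewrite genmxE; apply/sub_kermxP.
  exact: polytabloid_down.
rewrite sub -(geq_leqif (mxrank_leqif_sup sub)) mxrank_ker leq_subLR.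
rewrite -[X in (X <= _)%N](eqP (specht_add_up le_km)) addnC.
by rewrite -[\rank (down_mx k)]mxrank_tr (mxrank_adds_leqif _ _).1.
Qed.

Lemma specht_charS k (s : 'S_m) : (2 * k.+1 <= m)%N ->
  specht_char (shape k.+1) F s =
    \tr (tabloid_mx (shape k.+1) F s) - \tr (tabloid_mx (shape k) F s).
Proof.
move=> le_km; apply/eqP; rewrite eq_sym subr_eq; apply/eqP.
apply/esym; apply: (mxtrace_sub_ker (rG := tabloid_repr m (shape k.+1) F)
  (specht_module m (shape k.+1) F) (in_setT s) (specht_eq_ker le_km)).
  exact: down_mx_full.
exact: down_mx_act.
Qed.

(** For [k = 0] the empty product of differences is a polytabloid, and it spans the
    one-dimensional module of tabloids. *)
Lemma specht_char0 (s : 'S_m) :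
  specht_char (shape 0) F s = \tr (tabloid_mx (shape 0) F s).
Proof.
apply: (@mxtrace_submod1 _ _ _ _ (tabloid_repr m (shape 0) F)); last by rewrite inE.
apply/eqmxP; rewrite submx1 sub1mx; apply: tabloid_row_full => Z /eqP.
rewrite cards_eq0 => /eqP ->.
exact: (@diff_vec_sub_specht 0 [::]).
Qed.

Lemma mxtrace_tabloid k (s : 'S_m) :
  \tr (tabloid_mx (shape k) F s) = #|[set X in fixed_sets s | #|X| == k]|%:R.
Proof.
have -> : [set X in fixed_sets s | #|X| == k] =
          @lower_row k @: [set f | tabloid_act f s == f].
  apply/setP => X; rewrite !inE; apply/andP/imsetP => [[/eqP sX /eqP cardX]|].
    have [f defX] := lower_row_onto cardX; exists f => //.
    by rewrite inE -(inj_eq (@lower_row_inj k)) lower_row_act defX sX.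
  by case=> f; rewrite inE => /eqP fix_f ->; rewrite -lower_row_act fix_f card_lower_row !eqxx.
rewrite card_imset; last exact: lower_row_inj.
rewrite -sum1_card natr_sum big_mkcond /= /mxtrace.
rewrite (reindex_onto (@enum_rank _) (@enum_val _ _)) /=; last first.
  by move=> i _; rewrite enum_valK.
apply: eq_big => [f | f _]; first by rewrite enum_rankK eqxx.
rewrite !mxE inE enum_rankK /= (inj_eq enum_rank_inj) eq_sym.
by case: eqP.
Qed.

Lemma young_rule k (s : 'S_m) : (2 * k <= m)%N ->
  #|[set X in fixed_sets s | #|X| == k]|%:R =
    \sum_(0 <= j < k.+1) specht_char (shape j) F s.
Proof.
rewrite -mxtrace_tabloid.
elim: k => [|k IHk] le_km; first by rewrite big_nat1 specht_char0.
rewrite big_nat_recr //= -IHk; last by lia.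
by rewrite specht_charS // addrC subrK.
Qed.

Lemma fixed_setsC (s : 'S_m) k : (k <= m)%N ->
  #|[set X in fixed_sets s | #|X| == k]| =
  #|[set X in fixed_sets s | #|X| == m - k]|%N.
Proof.
move=> le_km; rewrite -(card_imset _ (@setC_inj _)); apply: eq_card => X.
rewrite -[X in LHS]setCK (mem_imset _ _ (@setC_inj _)) !inE.
have -> : s @: (~: X) = ~: (s @: X).
  apply/setP => i; rewrite -(permKV s i) !inE.
  by rewrite !(mem_imset _ _ perm_inj) inE.
rewrite (inj_eq (@setC_inj _)); congr andb.
have := cardsC X; rewrite card_ord.
by move: #|X| #|~: X| => a b; lia.
Qed.

(** Young's rule reaches the sizes [k] up to [m./2], and complementation the
    others: in all cases the Specht characters that occur are those with
    [j <= k <= m - j]. *)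
Lemma card_fixed_sets (s : 'S_m) :
  #|fixed_sets s|%:R =
    \sum_(0 <= j < (m./2).+1)
      (m - 2 * j + 1)%N%:R * specht_char (shape j) F s.
Proof.
have -> : #|fixed_sets s| =
    (\sum_(0 <= k < m.+1) #|[set X in fixed_sets s | #|X| == k]|)%N.
  rewrite big_mkord -sum1_card.
  rewrite (partition_big (fun X : {set 'I_m} => inord #|X| : 'I_m.+1) xpredT) //=.
  apply: eq_bigr => k _; rewrite -sum1_card; apply: eq_bigl => X.
  rewrite !inE -[inord _ == k]val_eqE /= inordK // ltnS.
  by rewrite -[X in (_ <= X)%N]card_ord max_card.
rewrite natr_sum.
transitivity (\sum_(0 <= k < m.+1) \sum_(0 <= j < (m./2).+1 | (j <= k <= m - j)%N)
                 specht_char (shape j) F s).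
  rewrite !big_nat; apply: eq_bigr => k /= le_km.
  have [le_k | lt_k] := leqP (2 * k) m.
    rewrite young_rule // (@big_nat_widen _ _ _ 0 k.+1 (m./2).+1) /=; last by lia.
    by apply: congr_big_nat => // j /= lt_j; lia.
  rewrite fixed_setsC // young_rule; last by lia.
  rewrite (@big_nat_widen _ _ _ 0 (m - k).+1 (m./2).+1) /=; last by lia.
  by apply: congr_big_nat => // j /= lt_j; lia.
rewrite (exchange_big_dep_nat xpredT) //=.
rewrite !big_nat; apply: eq_bigr => j /= lt_j.
transitivity (\sum_(j <= k < (m - j).+1) specht_char (shape j) F s).
  rewrite (@big_nat_widenl _ _ _ j 0) // (@big_nat_widen _ _ _ 0 (m - j).+1 m.+1);
    last by lia.
  by apply: eq_bigl => k; rewrite /= ltnS.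
rewrite sumr_const_nat mulr_natl; congr (_ *+ _); lia.
Qed.

End TwoRow.

(** * Counting isomorphism classes of graphs *)

Section GraphOrbits.

Local Open Scope nat_scope.

Variable n : nat.

Local Notation m := 'C(n, 2).

Lemma sgraph_of_subproof (X : {set 'I_m}) :
  [forall e in @edge n @: X, #|e| == 2].
Proof. by apply/forall_inP => _ /imsetP[k _ ->]; rewrite card_edge. Qed.

Definition sgraph_of (X : {set 'I_m}) : sgraph n :=
  Sub (@edge n @: X) (sgraph_of_subproof X).

Lemma edge_onto (e : {set 'I_n}) : #|e| = 2 -> exists k : 'I_m, edge k = e.
Proof.
move/eqP; rewrite -mem_edge_seq => e_in.
have lt_e : index e (edge_seq n) < m by rewrite -size_edge_seq index_mem.
by exists (Ordinal lt_e); rewrite /edge nth_index.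
Qed.

Lemma sgraph_of_bij : bijective sgraph_of.
Proof.
exists (fun G : sgraph n => @edge n @^-1: val G) => [X | G].
  by apply/setP => k; rewrite inE (mem_imset _ _ (@edge_inj n)).
apply/val_inj/setP => e; apply/imsetP/idP => [[k] | eG].
  by rewrite inE => kG ->.
have /edge_onto[k def_e] : #|e| = 2.
  by apply/eqP; have /forall_inP := valP G; apply.
by exists k; rewrite ?inE def_e.
Qed.

(** An isomorphism only has to be tested on the edges, as there are no loops and
    [edge] enumerates all pairs of vertices. *)
Lemma sgraph_iso_of (X Y : {set 'I_m}) :
  sgraph_iso (sgraph_of X) (sgraph_of Y) =
    [exists s : 'S_n, Y == edge_perm s @: X].
Proof.
apply/sgraph_isoP/existsP => -[s]; last first.
  move/eqP=> ->; exists s => x y; rewrite /adj /=.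
  have -> : @edge n @: (edge_perm s @: X) = [set s @: (e : {set 'I_n}) | e in @edge n @: X].
    by rewrite -!imset_comp; apply: eq_imset => k /=; rewrite edge_permE.
  have -> : [set s x; s y] = s @: [set x; y] by rewrite imsetU1 imset_set1.
  by rewrite (mem_imset _ _ (imset_inj (@perm_inj _ s))).
move=> iso; exists s; apply/eqP/setP => k.
rewrite -(permKV (edge_perm s) k) (mem_imset _ _ perm_inj).
move: (_ k) => {}k.
have /cards2P[x [y [_ def_k]]] : #|edge k| == 2 by rewrite card_edge.
have := iso x y; rewrite /adj /= -def_k (mem_imset _ _ (@edge_inj n)) => ->.
have -> : [set s x; s y] = edge (edge_perm s k).
  by rewrite edge_permE def_k imsetU1 imset_set1.
by rewrite (mem_imset _ _ (@edge_inj n)).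
Qed.

Definition edge_set_act (X : {set 'I_m}) (s : 'S_n) := edge_perm s @: X.

Lemma edge_set_act1 : edge_set_act^~ 1%g =1 id.
Proof.
move=> X; rewrite /edge_set_act morph1 -[RHS]imset_id.
by apply: eq_imset => k; rewrite perm1.
Qed.

Lemma edge_set_actM X : act_morph edge_set_act X.
Proof.
move=> s t; rewrite /edge_set_act morphM ?inE // -imset_comp.
by apply: eq_imset => k; rewrite permM.
Qed.

Canonical edge_set_action := TotalAction edge_set_act1 edge_set_actM.

Lemma num_graphs_orbits :
  num_graphs n = #|orbit edge_set_action [set: 'S_n] @: [set: {set 'I_m}]|.
Proof.
have [gr grK Kgr] := sgraph_of_bij.
have gr_inj := can_inj grK.
rewrite /num_graphs /equivalence_partition.
rewrite -(card_imset _ (imset_inj gr_inj)).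
apply: eq_card => C; rewrite -imset_comp.
have part_of X : [set H in [set: sgraph n] | sgraph_iso (sgraph_of X) H] =
    sgraph_of @: orbit edge_set_action [set: 'S_n] X.
  apply/setP => H; rewrite -(Kgr H) (mem_imset _ _ gr_inj) !inE /= sgraph_iso_of.
  apply/existsP/orbitP => [[s /eqP ->] | [s _ <-]]; first by exists s.
  by exists s.
apply/imsetP/imsetP => [[G _ ->] | [X _ ->]].
  by exists (gr G); rewrite ?inE // -{1}(Kgr G) part_of.
by exists (sgraph_of X); rewrite ?inE // part_of.
Qed.

Lemma sum_fixed_sets :
  \sum_(s : 'S_n) #|fixed_sets (edge_perm s)| = num_graphs n * n`!.
Proof.
rewrite num_graphs_orbits -card_Sn -cardsT -Frobenius_Cauchy; last first.
  by apply/actsP => s _ X; rewrite !inE.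
apply: eq_big => [s | s _]; first by rewrite inE.
by apply: eq_card => X; rewrite !inE sub1set inE.
Qed.

End GraphOrbits.

Theorem mainTheorem16 (R : realType) (n : nat) :
  let m := 'C(n, 2) in
  (num_graphs n)%:R =
    1 / n`!%:R *
    \sum_(s : 'S_n) \sum_(0 <= j < (m./2).+1)
      (m - 2 * j + 1)%N%:R *
      specht_char [:: (m - j)%N; j] R[i] (edge_perm s) :> R[i].
Proof.
move=> m; under eq_bigr => s _ do rewrite -card_fixed_sets.
rewrite -natr_sum sum_fixed_sets natrM div1r mulrC mulfK //.
by rewrite pnatr_eq0 -lt0n fact_gt0.
Qed.
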